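(* Let $k \ge 3$ and $t \ge 1$ be integers, let $s_0 = \left\lceil \frac{3t}{t+1} \right\rceil$, and let $G$ be a connected $\frac{t}{t(k-1)+1}$-tough graph with $n$ vertices. If $$n \ge \frac{s_0k^3 - (3s_0-2)k^2 + (2s_0-5)k + 6}{(k-2)^2}$$ and $$e(G) > \binom{n-s_0(k-2)-2}{2} + s_0\big(s_0(k-2)+2\big),$$ then $G$ contains a spanning $k$-tree.
   Context: All graphs are finite, undirected and simple. $e(G)=|E(G)|$ denotes the number of edges of $G$, and $c(G)$ denotes the number of connected components of $G$. For a real number $\tau$, a graph $G$ is $\tau$-tough if $|S| \ge \tau\cdot c(G-S)$ for every vertex subset $S \subseteq V(G)$ with $c(G-S) \ge 2$ (in particular every complete graph is $\tau$-tough for every $\tau$). For an integer $k \ge 2$, a $k$-tree is a tree $T$ with $d_T(v) \le k$ for every vertex $v \in V(T)$ (maximum degree at most $k$). A spanning $k$-tree of a connected graph $G$ is a $k$-tree $T$ that is a subgraph of $G$ with $V(T)=V(G)$. $\lceil c \rceil$ is the smallest integer greater than or equal to $c$. *)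

(* Defs.v *)
From mathcomp Require Import all_boot all_order all_algebra.

Set Implicit Arguments.
Unset Strict Implicit.
Unset Printing Implicit Defensive.

Import Order.TTheory GRing.Theory Num.Theory.

Record sgraph (T : finType) := SGraph {
  adj :> rel T;
  adj_sym : symmetric adj;
  adj_irr : irreflexive adj
}.

Section Graphs.

Variable T : finType.
Implicit Types (G : sgraph T) (A S : {set T}) (x y : T).

Definition edges G : {set {set T}} :=
  [set [set p.1; p.2] | p : T * T & G p.1 p.2].

Definition degree G x : nat := #|[set y | G x y]|.

Definition induced G A : rel T :=
  [rel x y | [&& x \in A, y \in A & G x y]].

(* Number of connected components of G[A].  The vertices outside A are isolated
   for [induced G A] and are not counted, so that c(G) = num_comp G setT and
   c(G - S) = num_comp G (~: S). *)
Definition num_comp G A : nat := n_comp (induced G A) A.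

Definition connected G : Prop := num_comp G [set: T] = 1.

(* The sequences [p] with [ucycle G p] of size 1 do not exist, and those of size
   2 traverse an edge back and forth: the cycles of G have size at least 3. *)
Definition acyclic G : Prop := forall p : seq T, ucycle G p -> size p <= 2.

Definition is_tree G : Prop := connected G /\ acyclic G.

Definition is_ktree (k : nat) G : Prop :=
  is_tree G /\ forall x, degree G x <= k.

Definition tough (R : realDomainType) (tau : R) G : Prop :=
  forall S, 2 <= num_comp G (~: S) ->
    (tau * (num_comp G (~: S))%:R <= #|S|%:R)%R.

Definition has_spanning_ktree (k : nat) G : Prop :=
  exists H : sgraph T, subrel H G /\ is_ktree k H.

End Graphs.

(* Main.v *)
Require Import Defs.
From mathcomp Require Import all_boot all_order all_algebra.
From mathcomp Require Import zify ring.

Import Order.TTheory GRing.Theory Num.Theory.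

(** The theorem combines Win's theorem with an edge count.

    Win's theorem ([win_theorem]): if G is connected and c(G - S) <= (k-2)|S| + 2 for
    every nonempty S, then G has a spanning k-tree.  Measure a connected
    spanning subgraph H by its excess, the sum over the vertices of
    max(0, deg - k); while the excess is positive it can be lowered.  Pass to a
    spanning tree F of H.  Call X a reducing set if the F-degrees are at least k
    in X and at most k outside, and every vertex v outside X can be brought below
    degree k by rearranging F only inside the components of F - X, with no vertex
    outside X exceeding degree k.  The set of all vertices of F-degree at least k
    is one; take a reducing set X that cannot be made smaller as follows.
    - If an edge uv of G joins two components of F - X, the rearrangements for u
      and v live in different components and can be made together
      ([reshapes_glue]).  There is then room for uv, and any edge of the cycle
      that it closes may be dropped.  The cycle meets X; drop a cycle edge at
      w in X.  If w has degree above k, the excess goes down.  Otherwise all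
      vertices of X on the cycle have degree exactly k and can each be brought
      below k in this way, so X without them is a smaller reducing set
      ([reducing_set_step]).
    - If there is no such edge, G - X has as many components as F - X, hence at
      least 2 + the sum over X of (deg - 2) of them as F is a tree
      ([num_comp_ge_tops]).  All degrees in X are at least k and one is larger,
      so c(G - X) >= (k-2)|X| + 3, against the hypothesis.

    The edge count: if G has no spanning k-tree, some S has
    c(G - S) >= (k-2)|S| + 3, and toughness turns this into |S| >= s0.  A graph
    with so many components after the removal of s vertices has at most
    f(s) = C(n - (k-2)s - 2, 2) + s((k-2)s + 2) edges, the extremal case being
    one large component and isolated vertices all joined to S
    ([card_edges_le]).  The quadratic f is convex, and the lower bound on n says
    precisely that f does not exceed f(s0) at the largest possible
    s = (n-3)/(k-1); so |E(G)| <= f(s0) ([edge_bound_mono]), a contradiction. *)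

(** * Deleting vertices and exchanging edges *)

Section Relations.

Set Implicit Arguments.
Unset Strict Implicit.

Variable T : finType.
Implicit Types (e H K : rel T) (X Y S : {set T}) (x y u v w z : T).

Definition deg H x : nat := #|[set y | H x y]|.

(** The graph H - X, with the vertices of X kept as isolated vertices; it is
    convertible to [induced H (~: X)] for a simple graph H. *)
Definition off X H : rel T := [rel x y | [&& x \in ~: X, y \in ~: X & H x y]].

Definition conn H : Prop := forall x y, connect H x y.

Definition same_at X H K : Prop := forall x y, x \in X -> H x y = K x y.

Lemma offE X H x y : off X H x y = [&& x \notin X, y \notin X & H x y].
Proof. by rewrite /off /= !inE. Qed.

Lemma off_sym X H : symmetric H -> symmetric (off X H).
Proof. by move=> sH x y; rewrite !offE sH andbCA. Qed.

Lemma connect_off_closed X H x y :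
  connect (off X H) x y -> x \notin X -> y \notin X.
Proof.
case/connectP=> p pp -> {y}; elim: p x pp => //= a p IHp x; rewrite offE => /andP[/and3P[_ aX _] pp] _.
exact: IHp pp aX.
Qed.

Lemma connect_local (A : pred T) e e' x y :
    (forall a b, A a -> e a b -> A b) -> (forall a b, A a -> e a b -> e' a b) ->
  A x -> connect e x y -> connect e' x y.
Proof.
move=> Acl Asub Ax /connectP[p]; elim: p x Ax => [|a p IHp] x Ax /=.
  by move=> _ ->; apply: connect0.
case/andP=> exa pp yE; apply: connect_trans (connect1 (Asub _ _ Ax exa)) _.
by apply: IHp => //; apply: Acl Ax exa.
Qed.

(** An edge with an endpoint in X is shared by H and K, and an edge avoiding X
    stays within a component of K - X; so reinserting a part of X preserves the
    relation between the components of H - X and of K - X. *)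
Lemma connect_off_shrink X Y H K :
    Y \subset X -> symmetric H -> symmetric K -> same_at X H K ->
    subrel (off X H) (connect (off X K)) ->
  subrel (off Y H) (connect (off Y K)).
Proof.
move=> YX sH sK HK sub x y; rewrite offE => /and3P[xY yY Hxy].
have [xX|xX] := boolP (x \in X).
  by apply: connect1; rewrite offE xY yY -HK.
have [yX|yX] := boolP (y \in X).
  by apply: connect1; rewrite offE xY yY sK -HK // sH.
have: connect (off X K) x y by apply: sub; rewrite offE xX yX.
apply: connect_sub => a b; rewrite offE => /and3P[aX bX Kab].
by apply: connect1; rewrite offE Kab (contra (subsetP YX a)) ?(contra (subsetP YX b)).
Qed.

(** The graph e + uv - wz. *)
Definition exchange e u v w z : rel T :=
  fun x y => e x y && ((x, y) \notin [:: (w, z); (z, w)])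
             || ((x, y) \in [:: (u, v); (v, u)]).

Lemma exchangeE e u v w z x y : exchange e u v w z x y =
  e x y && ~~ ((x == w) && (y == z) || (x == z) && (y == w))
  || ((x == u) && (y == v) || (x == v) && (y == u)).
Proof. by rewrite /exchange /= !inE !xpair_eqE. Qed.

Lemma exchange_sym e u v w z : symmetric e -> symmetric (exchange e u v w z).
Proof.
move=> se x y; rewrite /exchange /= !inE !xpair_eqE se.
by congr (_ && ~~ _ || _); rewrite orbC; congr (_ || _); rewrite andbC.
Qed.

(** The path u .. w z .. v together with uv is a cycle, and deleting an edge of a
    cycle disconnects nothing. *)
Lemma connect_exchange e u v w z p1 p2 :
    symmetric e -> path e u (rcons p1 w ++ z :: p2) -> last z p2 = v ->
    uniq (u :: rcons p1 w ++ z :: p2) ->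
  connect (exchange e u v w z) =2 connect e.
Proof.
move=> se pe lv; move: pe; rewrite cat_path last_rcons => /andP[pu /andP[ewz pz]].
rewrite -cat_cons cat_uniq => /and3P[U1 disj U2].
have s' := exchange_sym u v w z se.
have csym := sym_connect_sym s'.
have zN : z \notin u :: rcons p1 w.
  by apply: contra disj => zi; apply/hasP; exists z; rewrite ?inE ?eqxx.
have wN : w \notin z :: p2.
  apply: contra disj => wi; apply/hasP; exists w => //.
  by rewrite /= inE mem_rcons inE eqxx orbT.
(* By uniqueness the part of the path up to w avoids z and the part from z on
   avoids w, so neither part uses the deleted edge. *)
have keep q x c : path e x q -> c \notin x :: q -> c \in [:: w; z] ->
    path (exchange e u v w z) x q.
  elim: q x => //= a q IHq x /andP[exa pq]; rewrite !inE !negb_or => /and3P[cx ca cq] cc.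
  rewrite IHq ?inE ?negb_or ?ca // andbT /exchange /= exa !inE !xpair_eqE /=.
  by case/orP: cc => /eqP cE; subst c; rewrite !(eq_sym x) !(eq_sym a)
    ?(negbTE cx) ?(negbTE ca) ?andbF.
have cuw : connect (exchange e u v w z) u w.
  apply/connectP; exists (rcons p1 w); last by rewrite last_rcons.
  by apply: keep zN _; rewrite ?inE ?eqxx ?orbT.
have czv : connect (exchange e u v w z) z v.
  apply/connectP; exists p2 => //.
  by apply: keep wN _; rewrite ?inE ?eqxx ?orbT.
have cuv : connect (exchange e u v w z) u v.
  by apply: connect1; rewrite /exchange /= !inE eqxx orbT.
have cwz : connect (exchange e u v w z) w z.
  rewrite csym; apply: connect_trans czv _; rewrite csym.
  by apply: connect_trans cuv; rewrite csym.
have euv : connect e u v.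
  apply/connectP; exists (rcons p1 w ++ z :: p2).
    by rewrite cat_path last_rcons /= pu ewz.
  by rewrite last_cat last_rcons.
move=> x y; apply/idP/idP; apply: connect_sub => a b.
  rewrite /exchange /= !inE !xpair_eqE => /orP[/andP[/connect1 //]|].
  by case/orP=> /andP[/eqP-> /eqP->] //; rewrite (sym_connect_sym se).
move=> eab; case E: ((a, b) \in [:: (w, z); (z, w)]); last first.
  by apply: connect1; rewrite /exchange /= E eab.
by move: E; rewrite !inE !xpair_eqE => /orP[] /andP[/eqP-> /eqP->] //; rewrite csym.
Qed.

Lemma deg_exchange e u v w z x :
  x != u -> x != v -> deg (exchange e u v w z) x <= deg e x.
Proof.
move=> xu xv; apply/subset_leq_card/subsetP => y; rewrite !inE exchangeE.
by rewrite (negbTE xu) (negbTE xv) orbF => /andP[].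
Qed.

Lemma deg_exchange_lt e u v w z :
  e w z -> w != u -> w != v -> deg (exchange e u v w z) w < deg e w.
Proof.
move=> ewz wu wv; apply/proper_card/properP; split.
  by apply/subsetP => y; rewrite !inE exchangeE (negbTE wu) (negbTE wv) orbF => /andP[].
by exists z; rewrite inE ?exchangeE ?(negbTE wu) ?(negbTE wv) ?eqxx ?andbF.
Qed.

Lemma deg_exchange_end e u v w z x :
  u != v -> x \in [:: u; v] -> deg (exchange e u v w z) x <= (deg e x).+1.
Proof.
move=> uv xuv; pose x' := if x == u then v else u.
apply: (@leq_trans #|x' |: [set y | e x y]|); last first.
  by rewrite cardsU1; case: (_ \notin _); rewrite ?add1n ?add0n // /deg ltnW.
apply/subset_leq_card/subsetP => y; rewrite !inE exchangeE /x'.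
case/orP=> [/andP[->]|]; first by rewrite orbT.
case/orP=> /andP[/eqP-> /eqP->]; first by rewrite !eqxx.
by rewrite (eq_sym v) (negbTE uv) eqxx.
Qed.


(** * Rooted spanning trees *)

(** A tree rooted at r is given by its parent map; the depth-like function d
    decreases along it, which rules out cycles. *)
Definition parented r (pi : T -> T) (d : T -> nat) : Prop :=
  forall x, x != r -> d (pi x) < d x.

Definition tree_rel r (pi : T -> T) : rel T :=
  fun x y => (x != r) && (y == pi x) || (y != r) && (x == pi y).

(** Breadth-first search from r: d is the distance to r, and a parent is any
    neighbour nearer to r. *)
Lemma parents_of_conn H r : conn H ->
  exists pi d, parented r pi d /\ forall x, x != r -> H (pi x) x.
Proof.
move=> cH.
pose reach x n := [exists p : n.-tuple T, path H r p && (last r p == x)].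
have reachI p : path H r p -> reach (last r p) (size p).
  by move=> pp; apply/existsP; exists (in_tuple p); rewrite pp eqxx.
have ex_reach x : exists n, reach x n.
  by have /connectP[p pp ->] := cH r x; exists (size p); apply: reachI.
pose d x := ex_minn (ex_reach x).
have d_le p : path H r p -> d (last r p) <= size p.
  by move=> pp; rewrite /d; case: ex_minnP => m _; apply; apply: reachI.
have step x : x != r -> exists y, H y x && (d y < d x).
  move=> xr; rewrite {2}/d; case: ex_minnP => m /existsP[[p /= /eqP <-]] /andP[pp /eqP lp] _.
  case/lastP: p pp lp => [_ /= rx|p y]; first by rewrite rx eqxx in xr.
  rewrite rcons_path last_rcons size_rcons => /andP[pp Hy] <-.
  by exists (last r p); rewrite Hy ltnS d_le.
exists (fun x => odflt x [pick y | H y x && (d y < d x)]), d.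
by split=> x /step[y0 y0P]; case: pickP => [y /andP[] //|/(_ y0)]; rewrite y0P.
Qed.

Section Parents.

Variables (r : T) (pi : T -> T) (d : T -> nat).
Hypothesis dP : parented r pi d.
Let F := tree_rel r pi.

Lemma tree_rel_sym : symmetric F.
Proof. by move=> x y; rewrite /F /tree_rel orbC. Qed.

Lemma tree_rel_conn : conn F.
Proof.
have Fs := sym_connect_sym tree_rel_sym.
suff toroot x : connect F x r.
  by move=> x y; apply: connect_trans (toroot x) _; rewrite Fs.
have [n] := ubnP (d x); elim: n x => // n IHn x dx.
have [->|xr] := eqVneq x r; first exact: connect0.
apply: connect_trans (connect1 _) (IHn (pi x) _); first by rewrite /F /tree_rel xr eqxx.
exact: leq_trans (dP xr) dx.
Qed.

Lemma tree_rel_irr : irreflexive F.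
Proof.
move=> x; rewrite /F /tree_rel orbb; apply/negP => /andP[xr /eqP xE].
by have := dP xr; rewrite -xE ltnn.
Qed.

Lemma tree_rel_up x y : F x y -> d y <= d x -> y = pi x.
Proof.
case/orP=> /andP[yr /eqP //] xE dyx.
by have := dP yr; rewrite -xE ltnNge dyx.
Qed.

(** A vertex of largest depth on a cycle would have both of its two cycle
    neighbours as parents. *)
Lemma tree_rel_acyclic p : cycle F p -> uniq p -> size p <= 2.
Proof.
move=> cp up; rewrite leqNgt; apply/negP => sp.
have p0 : 0 < size p by apply: leq_trans sp.
have [x0 x0p] : exists x0, x0 \in p by case: (p) p0 => // a q _; exists a; rewrite inE eqxx.
case: (arg_maxnP d x0p) => x xp dmax.
have [i q rotE] := rot_to xp.
have cq : cycle F (x :: q) by rewrite -rotE rot_cycle.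
have uq : uniq (x :: q) by rewrite -rotE rot_uniq.
have memq y : y \in x :: q -> d y <= d x.
  by rewrite -rotE mem_rot; apply: dmax.
have sq : 2 <= size q by rewrite -ltnS -[(size q).+1]/(size (x :: q)) -rotE size_rot.
clear rotE; case: q sq cq uq memq => [|y q] //; case/lastP: q => [//|q z] _.
rewrite /= rcons_path last_rcons => /and3P[Fxy _ Fzx] uq memq.
have yE : y = pi x by apply: tree_rel_up Fxy _; apply: memq; rewrite !inE eqxx orbT.
have zE : z = pi x.
  apply: tree_rel_up; first by rewrite tree_rel_sym.
  by apply: memq; rewrite !inE mem_rcons inE eqxx !orbT.
by move: uq; rewrite yE zE mem_rcons inE eqxx /= andbF.
Qed.

Variable X : {set T}.

(** The vertices of least depth in the components of F - X: each component has
    exactly one, so they stand for the components. *)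
Definition tops : {set T} := [set v in ~: X | (v == r) || (pi v \in X)].

(** Climbing from a vertex towards the root for as long as X is avoided ends in a
    top, and the two ends of an edge of F - X climb to the same one. *)
Lemma connect_tops_inj x y :
  x \in tops -> y \in tops -> connect (off X F) x y -> x = y.
Proof.
pose step v := if (v == r) || (pi v \in X) then v else pi v.
(* Any number of steps at least the depth of every vertex will do. *)
pose N := \sum_v d v.
have stop n v : d v <= n -> step (iter n step v) = iter n step v.
  elim: n v => [|n IHn] v dv.
    rewrite /= /step; case: ifPn => // /norP[/dP]; rewrite ltnNge.
    by move: dv; rewrite leqn0 => /eqP->.
  rewrite iterSr; have [vt|/norP[vr vX]] := boolP ((v == r) || (pi v \in X)).
    have fixv: step v = v by rewrite /step vt.
    have fixi m : iter m step v = v by elim: m => //= m ->.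
    by rewrite fixv fixi.
  by apply: IHn; rewrite /step (negbTE vr) (negbTE vX) /= -ltnS (leq_trans (dP vr)).
have dN v : d v <= N by rewrite /N (bigD1 v) //= leq_addr.
have top_id v : v \in tops -> iter N step v = v.
  rewrite !inE => /andP[_ vt]; have fixv: step v = v by rewrite /step vt.
  by have fixi m : iter m step v = v by elim: m => //= m ->.
have up v : v != r -> pi v \notin X -> iter N step (pi v) = iter N step v.
  move=> vr vX; have <- : step v = pi v by rewrite /step (negbTE vr) (negbTE vX).
  by rewrite -iterSr /= stop.
have edge a b : off X F a b -> iter N step a = iter N step b.
  rewrite offE => /and3P[aX bX /orP[] /andP[vr /eqP E]]; rewrite E in aX bX *.
    by rewrite up.
  by rewrite up.
move=> xt yt /connectP[p pp yE]; rewrite -(top_id x) // -(top_id y) //.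
rewrite yE {yE yt}; elim: p x pp {xt} => //= a p IHp x /andP[xa pp].
by rewrite (edge _ _ xa) IHp.
Qed.

(** Each non-root vertex owns the edge to its parent.  The degrees over X count
    the owned edges of X and the set A of vertices with parent in X.  A vertex of
    A lies outside X, and is then a top, or in X; the shallowest vertex of X is
    not in A, which bounds the second kind by |X| - 1. *)
Lemma sum_deg_tops :
  X != set0 -> \sum_(x in X) deg F x + 2 <= #|tops| + 2 * #|X|.
Proof.
case/set0Pn=> x0 x0X; pose A := [set y | (y != r) && (pi y \in X)].
have degF x : deg F x <= #|[set y in A | pi y == x]| + (x != r) \/ x \notin X.
  have [xX|] := boolP (x \in X); [left | by right].
  apply: (@leq_trans #|[set y in A | pi y == x] :|: [set y | (x != r) && (y == pi x)]|).
    apply/subset_leq_card/subsetP => y; rewrite !inE /F /tree_rel.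
    case/orP=> [->|/andP[yr /eqP <-]]; first by rewrite orbT.
    by rewrite yr xX eqxx.
  rewrite (leq_trans (leq_card_setU _ _)) // leq_add2l.
  case: (x != r) => /=; last first.
    by rewrite (_ : [set y | _] = set0) ?cards0 //; apply/setP => y; rewrite !inE.
  by rewrite -(cards1 (pi x)) subset_leq_card //; apply/subsetP => y; rewrite !inE.
have sumdeg : \sum_(x in X) deg F x <= #|A| + #|X :\ r|.
  apply: (@leq_trans (\sum_(x in X) (#|[set y in A | pi y == x]| + (x != r)))).
    by apply: leq_sum => x xX; case: (degF x); rewrite ?xX.
  rewrite big_split /= leq_add //.
    rewrite -[#|A|]sum1_card [leqRHS](partition_big pi (mem X)) /=; last first.
      by move=> y; rewrite /A inE => /andP[].
    by apply: leq_sum => x xX; rewrite sum1dep_card.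
  rewrite -sum1_card [leqRHS](eq_bigl (fun x => (x \in X) && (x != r))) ?[leqRHS]big_mkcondr; last first.
    by move=> x; rewrite !inE andbC.
  by apply: leq_sum => x _; case: (x != r).
have AX : #|A :&: X| < #|X|.
  case: (arg_minnP d x0X) => m mX' dmin; have mX : m \in X := mX'.
  apply/proper_card/properP; split; first exact: subsetIr.
  exists m => //; rewrite !inE mX andbT; apply/negP => /andP[mr /dmin].
  by rewrite leqNgt dP.
have At : #|A :\: X| <= #|tops :\ r|.
  apply/subset_leq_card/subsetP => y; rewrite !inE => /and3P[-> -> ->].
  by rewrite orbT.
have rt : (r \in tops) = (r \notin X) by rewrite !inE eqxx andbT.
have := cardsID X A; have := cardsD1 r X; have := cardsD1 r tops; rewrite rt.
by case: (r \in X) => /=; lia.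
Qed.

End Parents.

(** When G has no edge between different components of F - X, the components of
    G - X are those of F - X. *)
Lemma num_comp_ge_tops r pi d (G : sgraph T) X :
    parented r pi d -> X != set0 ->
    (forall u v, off X G u v -> connect (off X (tree_rel r pi)) u v) ->
  \sum_(x in X) deg (tree_rel r pi) x + 2 <= num_comp G (~: X) + 2 * #|X|.
Proof.
move=> dP X0 sub; apply: leq_trans (sum_deg_tops dP X0) _; rewrite leq_add2r.
have sG : connect_sym (off X G) by apply/sym_connect_sym/off_sym/adj_sym.
rewrite -(@card_in_imset _ _ (fingraph.root (off X G))); last first.
  move=> x y xt yt /eqP; rewrite fingraph.root_connect // => cxy.
  by apply: (connect_tops_inj dP xt yt); apply: connect_sub cxy.
apply/subset_leq_card/subsetP => _ /imsetP[x xt ->].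
rewrite inE roots_root //= inE.
apply: connect_off_closed (connect_root _ x) _.
by move: xt; rewrite !inE => /andP[].
Qed.

(** * Lowering the excess of a connected spanning subgraph *)

Definition excess k H : nat := \sum_x (deg H x - k).

(** K arises from F by rearranging edges inside the components of F - X only,
    without creating a degree above k outside X. *)
Definition reshapes k (G : rel T) F X K : Prop :=
  [/\ symmetric K, subrel K G, same_at X K F,
      connect (off X K) =2 connect (off X F)
    & forall x, x \notin X -> deg K x <= k].

(** The last clause is the point: room for one more edge can be made at any
    single vertex outside X at no cost in excess. *)
Definition reducing_set k (G : rel T) F X : Prop :=
  [/\ forall x, x \in X -> k <= deg F x,
      forall x, x \notin X -> deg F x <= k
    & forall v, v \notin X -> exists2 K, reshapes k G F X K & deg K v < k].

Lemma same_at_deg X H K x : same_at X H K -> x \in X -> deg H x = deg K x.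
Proof. by move=> HK xX; apply: eq_card => y; rewrite !inE HK. Qed.

Lemma path_off X H x p :
  path H x p -> {in x :: p, forall y, y \notin X} -> path (off X H) x p.
Proof.
elim: p x => //= a p IHp x /andP[xa pp] pX.
rewrite offE xa !pX ?inE ?eqxx ?orbT //=; apply: IHp => // y yp.
by apply: pX; rewrite inE yp orbT.
Qed.

Section Exchange.

Variables (k : nat) (G F : rel T).
Hypotheses (Gs : symmetric G) (Fs : symmetric F).

(** With Y deleted instead of X, fewer edges have to be kept, and the components
    still match by [connect_off_shrink].  The reinserted vertices have the same
    degree in K as in F, whence the hypothesis on them. *)
Lemma reshapes_shrink X Y K :
    Y \subset X -> (forall x, x \in X -> x \notin Y -> deg F x <= k) ->
  reshapes k G F X K -> reshapes k G F Y K.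
Proof.
move=> YX degXY [Ks KG KF cK dK]; split=> //.
- by move=> x y xY; apply: KF; apply: (subsetP YX).
- have FK : same_at X F K by move=> x y /KF->.
  move=> x y; apply/idP/idP; apply: connect_sub.
    by apply: connect_off_shrink YX Ks Fs KF _ => a b /connect1; rewrite cK.
  by apply: connect_off_shrink YX Fs Ks FK _ => a b /connect1; rewrite cK.
move=> x xY; have [xX|/dK//] := boolP (x \in X).
by rewrite (same_at_deg KF xX) degXY.
Qed.

Lemma conn_off0 H : conn H <-> conn (off set0 H).
Proof.
have E : off set0 H =2 H by move=> x y; rewrite offE !inE.
by split=> cH x y; [rewrite (eq_connect E) | rewrite -(eq_connect E)].
Qed.

Lemma reshapes_conn X K : conn F -> reshapes k G F X K -> conn K.
Proof.
move=> /conn_off0 cF [Ks KG KF cK dK]; apply/conn_off0 => x y.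
apply: connect_sub (cF x y); apply: connect_off_shrink (sub0set X) Fs Ks _ _.
  by move=> a b /KF->.
by move=> a b /connect1; rewrite cK.
Qed.

(** Use Ku in the component of u in F - X and Kv elsewhere.  No edge of Ku or Kv
    leaves this component except to X, where both agree with F, so the result is
    symmetric and every vertex keeps its degree from Ku or from Kv. *)
Lemma reshapes_glue X u v Ku Kv :
    u \notin X -> ~~ connect (off X F) u v ->
    reshapes k G F X Ku -> reshapes k G F X Kv ->
  exists K, [/\ reshapes k G F X K, deg K u = deg Ku u & deg K v = deg Kv v].
Proof.
move=> uX uv [Kus KuG KuF cKu dKu] [Kvs KvG KvF cKv dKv].
pose C x := connect (off X F) u x.
pose K : rel T := fun x y => if C x then Ku x y else Kv x y.
have CX x : C x -> x \notin X by move/connect_off_closed; apply.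
have sF := sym_connect_sym (off_sym X Fs).
have Cstep x y : C x -> connect (off X F) x y -> C y by apply: connect_trans.
have cross x y : C x -> ~~ C y -> Ku x y = Kv y x.
  move=> Cx Cy; have [yX|yX] := boolP (y \in X); first by rewrite Kus KuF // KvF.
  have xX := CX x Cx; apply/idP/idP => Exy; case/negP: Cy; apply: Cstep Cx _.
    by rewrite -cKu connect1 // offE xX yX.
  by rewrite -cKv connect1 // offE xX yX Kvs.
exists K; split; [split | by rewrite /deg /K /C connect0 | by rewrite /deg /K /C (negbTE uv)].
- move=> x y; rewrite /K; case: (boolP (C x)) (boolP (C y)) => Cx [] Cy //.
  + exact: cross.
  + by rewrite (cross y x).
- by move=> x y; rewrite /K; case: (C x); [apply: KuG | apply: KvG].
- by move=> x y xX; rewrite /K; case: (C x); [apply: KuF | apply: KvF].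
- move=> x y; apply/idP/idP.
    apply: connect_sub => a b; rewrite offE /K => /and3P[aX bX].
    case: (C a) => Kab; [rewrite -cKu | rewrite -cKv];
      by apply: connect1; rewrite offE aX bX.
  have [Cx|Cx] := boolP (C x).
    rewrite -cKu; apply: (@connect_local C) => // a b Ca Kab.
      by apply: Cstep Ca _; rewrite -cKu connect1.
    by move: Kab; rewrite !offE /K Ca.
  rewrite -cKv; apply: (@connect_local (predC C)) => // a b /= Ca Kab.
    by apply: contra Ca => Cb; apply: Cstep Cb _; rewrite sF -cKv connect1.
  by move: Kab; rewrite !offE /K (negbTE Ca).
- by move=> x xX; rewrite /deg /K; case: (C x); [apply: dKu | apply: dKv].
Qed.

(** An edge uv between two components of F - X either lowers the excess or
    shrinks the reducing set.  The rearrangement K makes room at u and v; a u-v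
    path in K must meet X.  The graphs K + uv - wz, for w in X on the path and z
    its successor there, settle both alternatives.  All the vertices of X on the
    path leave X at once: z may itself lie in X, and the edges at the vertices
    that remain in X must not change. *)
Lemma reducing_set_step X u v :
    subrel F G -> conn F -> reducing_set k G F X ->
    u \notin X -> v \notin X -> G u v -> ~~ connect (off X F) u v ->
  (exists K, [/\ symmetric K, subrel K G, conn K & excess k K < excess k F])
  \/ (exists2 Y : {set T}, Y \proper X & reducing_set k G F Y).
Proof.
move=> FG cF [degX degNX redX] uX vX Guv uv.
have [Ku rKu dKu] := redX u uX; have [Kv rKv dKv] := redX v vX.
have [K [rK dKuE dKvE]] := reshapes_glue uX uv rKu rKv.
have cK := reshapes_conn cF rK; case: (rK) => Ks KG KF cKF dK.
have uDv : u != v by apply: contraNneq uv => ->; apply: connect0.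
have /connectP[p0 pp0 lv0] := cK u v.
case: (shortenP pp0) lv0 => p pp up _ lv {p0 pp0}.
(* Removing only the path from X puts the whole cycle off Y. *)
pose Y : {set T} := X :\: [set x in p].
have YX : Y \subset X by apply: subsetDl.
have pY : {in u :: p, forall y, y \notin Y}.
  move=> y; rewrite !inE => /orP[/eqP->|->] //.
  by rewrite (negbTE uX) andbF.
have vp : v \in p.
  by rewrite lv; case: (p) lv => [uE|a q _] /=; [rewrite uE eqxx in uDv | apply: mem_last].
have cut w : w \in X -> w \in p -> exists z, [/\ z \in p, K w z &
    forall Z : {set T}, Z \subset Y ->
    connect (off Z (exchange K u v w z)) =2 connect (off Z K)].
  move=> wX wp; case/path.splitP: wp pp up lv pY vp => p1 p2 pp up lv pY vp.
  case: p2 pp up lv pY vp => [|z p2] pp up lv pY vp.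
    by move: lv vX; rewrite cats0 last_rcons => ->; rewrite wX.
  exists z; split; first by rewrite mem_cat inE eqxx orbT.
    by move: pp; rewrite cat_path last_rcons /= => /and3P[].
  move=> Z ZY.
  have pZ : {in u :: rcons p1 w ++ z :: p2, forall y, y \notin Z}.
    by move=> y /pY; apply/contra/subsetP.
  have E : off Z (exchange K u v w z) =2 exchange (off Z K) u v w z.
    move=> x y; rewrite offE !exchangeE offE.
    have uZ : u \notin Z by apply: pZ; rewrite inE eqxx.
    have vZ : v \notin Z by apply: pZ; rewrite inE vp orbT.
    have Duv a : a \in Z -> (a == u = false) * (a == v = false).
      by move=> aZ; split; apply: contraTF aZ => /eqP->.
    have [xZ|xZ] /= := boolP (x \in Z); first by rewrite !(Duv _ xZ).
    by have [yZ|//] /= := boolP (y \in Z); rewrite !(Duv _ yZ) !andbF.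
  move=> x y; rewrite (eq_connect E); apply: (@connect_exchange (off Z K) u v w z p1 p2) => //.
  - exact: off_sym.
  - exact: path_off.
  by rewrite lv last_cat last_rcons.
have dK' w z x : x \notin X -> deg (exchange K u v w z) x <= k.
  move=> xX; have [xuv|] := boolP (x \in [:: u; v]).
    apply: leq_trans (deg_exchange_end _ _ _ uDv xuv) _.
    by move: xuv; rewrite !inE => /orP[]/eqP->; rewrite ?dKuE ?dKvE.
  by rewrite !inE => /norP[xu xv]; apply: leq_trans (deg_exchange _ _ _ xu xv) (dK x xX).
have XDuv w : w \in X -> (w != u) * (w != v).
  by move=> wX; split; apply: contraTneq wX => ->.
have dKlt w z : w \in X -> K w z -> deg (exchange K u v w z) w < deg F w.
  by move=> wX Kwz; rewrite -(same_at_deg KF wX) deg_exchange_lt // XDuv.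
have K's w z : symmetric (exchange K u v w z) by apply: exchange_sym.
have K'G w z : subrel (exchange K u v w z) G.
  move=> x y; rewrite exchangeE => /orP[/andP[/KG]//|].
  by case/orP=> /andP[/eqP-> /eqP->] //; rewrite Gs.
(* A path vertex of X above degree k lowers the excess; the endpoints u and v
   had degree below k, so they contribute no new excess. *)
case: (boolP [exists w in X, (w \in p) && (k < deg F w)]).
  case/exists_inP=> w wX /andP[wp kw]; left.
  have [z [zp Kwz cK']] := cut w wX wp.
  exists (exchange K u v w z); split=> //.
    apply/conn_off0 => x y; rewrite cK' ?sub0set //.
    by move: cK => /conn_off0; apply.
  rewrite /excess (bigD1 w) // [ltnRHS](bigD1 w) //= -addSn leq_add //.
    exact: ltn_sub2r kw (dKlt w z wX Kwz).
  apply: leq_sum => x _; have [xX|xX] := boolP (x \in X).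
    by rewrite leq_sub2r // -(same_at_deg KF xX) deg_exchange // XDuv.
  by have := dK' w z x xX; rewrite -subn_eq0 => /eqP->.
(* Otherwise every path vertex of X has degree exactly k, hence drops below k
   when it loses its path edge. *)
move=> /exists_inPn small; right; exists Y.
  apply/properP; split=> //.
  have /existsP[w /andP[wX wp]] : [exists w, (w \in X) && (w \in p)].
    apply: contraR uv => /existsPn none; rewrite -cKF; apply/connectP.
    exists p => //; apply: path_off => // y; rewrite inE => /orP[/eqP->//|yp].
    by move: (none y); rewrite yp andbT.
  by exists w => //; rewrite !inE wp.
have degY x : x \in X -> x \notin Y -> deg F x <= k.
  move=> xX; rewrite !inE xX andbT negbK => xp.
  by move: (small x xX); rewrite xp /= -leqNgt.
split.
- by move=> x /(subsetP YX); apply: degX.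
- by move=> x xY; have [xX|/degNX//] := boolP (x \in X); apply: degY.
move=> w wY; have [wX|wX] := boolP (w \in X); last first.
  by have [H rH dH] := redX w wX; exists H => //; apply: reshapes_shrink rH.
have wp : w \in p by move: wY; rewrite !inE wX andbT negbK.
have [z [zp Kwz cK']] := cut w wX wp.
exists (exchange K u v w z); last by apply: leq_trans (dKlt w z wX Kwz) (degY w wX wY).
have [_ _ KFY cKY dKY] := reshapes_shrink YX degY rK.
split=> //.
- move=> x y xY; rewrite exchangeE -KFY //.
  have xD a : a \in u :: p -> x == a = false.
    by move=> ap; apply: contraTF xY => /eqP->; apply: pY.
  by rewrite !xD ?inE ?wp ?zp ?vp ?eqxx ?orbT //= andbT orbF.
- by move=> x y; rewrite cK' // cKY.
move=> x xY; have [xX|xX] := boolP (x \in X); last exact: dK'.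
apply: leq_trans (degY x xX xY); rewrite -(same_at_deg KF xX).
by rewrite deg_exchange // XDuv.
Qed.

End Exchange.

(** Start from X the set of all vertices of degree at least k, where F itself
    witnesses that X is reducing, and shrink X while possible.  When no further
    step exists, the tree count for X contradicts the hypothesis on G. *)
Lemma reduce_excess (G : sgraph T) k r pi d :
    2 <= k -> parented r pi d -> subrel (tree_rel r pi) G ->
    (forall S, S != set0 -> num_comp G (~: S) <= (k - 2) * #|S| + 2) ->
    0 < excess k (tree_rel r pi) ->
  exists K, [/\ symmetric K, subrel K G, conn K
              & excess k K < excess k (tree_rel r pi)].
Proof.
move=> k2 dP; set F := tree_rel r pi => FG few; rewrite lt0n => exF.
have Fs : symmetric F := tree_rel_sym r pi.
have cF : conn F := tree_rel_conn dP.
suff main n X : #|X| < n -> reducing_set k G F X ->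
    exists K, [/\ symmetric K, subrel K G, conn K & excess k K < excess k F].
  apply: (main _ [set x | k <= deg F x] (leqnn _)); split=> [x|x|v].
  - by rewrite inE.
  - by rewrite inE -ltnNge => /ltnW.
  rewrite inE -ltnNge => vk; exists F => //; split=> // x.
  by rewrite inE -ltnNge => /ltnW.
elim: n X => // n IHn X Xn redX.
case: (boolP [exists u, exists v, off X G u v && ~~ connect (off X F) u v]).
  case/existsP=> u /existsP[v]; rewrite offE => /andP[/and3P[uX vX Guv] uv].
  have [//|[Y /proper_card YX redY]] :=
    reducing_set_step (@adj_sym _ G) Fs FG cF redX uX vX Guv uv.
  by apply: (IHn Y) => //; apply: leq_trans YX _.
move=> nex; exfalso; case: redX => degX degNX _.
have [w wk] : exists w, k < deg F w.
  apply/existsP; apply: contraR exF => /existsPn small.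
  rewrite /excess big1 // => x _; apply/eqP; rewrite subn_eq0.
  by have := small x; rewrite -leqNgt.
have wX : w \in X by apply: contraTT wk => /degNX; rewrite -leqNgt.
have X0 : X != set0 by apply/set0Pn; exists w.
have sub u v : off X G u v -> connect (off X F) u v.
  move=> Guv; apply: contraR nex => uv.
  by apply/existsP; exists u; apply/existsP; exists v; rewrite Guv.
have := num_comp_ge_tops dP X0 sub; rewrite -/F.
have : k * #|X| < \sum_(x in X) deg F x.
  rewrite mulnC -sum_nat_const (bigD1 w) //= [ltnRHS](bigD1 w) //= -addSn.
  by rewrite leq_add // leq_sum // => x /andP[/degX].
have := few X X0; rewrite mulnBl; have : 2 * #|X| <= k * #|X| by rewrite leq_mul2r k2 orbT.
lia.
Qed.

Lemma connP (G : sgraph T) : connected G -> conn G.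
Proof.
have E : induced G [set: T] =2 G by move=> x y; rewrite /induced /= !inE.
have sG : connect_sym G by apply/sym_connect_sym/adj_sym.
rewrite /connected /num_comp (eq_n_comp (eq_connect E)) => c1 x y.
rewrite -(fingraph.root_connect sG); apply/eqP.
have /card_le1_eqP : n_comp G [set: T] <= 1 by rewrite c1.
by apply; rewrite !inE roots_root.
Qed.

Lemma conn_connected (G : sgraph T) (r : T) : conn G -> connected G.
Proof.
have E : induced G [set: T] =2 G by move=> x y; rewrite /induced /= !inE.
have sG : connect_sym G by apply/sym_connect_sym/adj_sym.
move=> cG; rewrite /connected /num_comp (eq_n_comp (eq_connect E)).
rewrite -(n_comp_connect sG r); apply: eq_n_comp_r => x.
by rewrite inE; symmetry; apply: cG.
Qed.

(** Win's theorem.  Once the excess is zero, a rooted tree inside the connected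
    subgraph reached is the spanning k-tree. *)
Theorem win_theorem (G : sgraph T) k :
    2 <= k -> connected G ->
    (forall S, S != set0 -> num_comp G (~: S) <= (k - 2) * #|S| + 2) ->
  has_spanning_ktree k G.
Proof.
move=> k2 cG few.
have [r _] : exists r : T, true.
  apply/existsP; rewrite -[[exists _, _]]negbK; apply/existsPn => none.
  move: cG; rewrite /connected /num_comp /n_comp_mem eq_card0 // => x.
  by have := none x.
suff main n H : excess k H < n -> symmetric H -> subrel H G -> conn H ->
    has_spanning_ktree k G.
  by apply: (main _ G (leqnn _)); [apply: adj_sym | | apply: connP].
elim: n H => // n IHn H Hn Hs HG cH.
have [pi [d [dP Hpi]]] := parents_of_conn r cH.
have FH : subrel (tree_rel r pi) H.
  by move=> x y /orP[]/andP[xr /eqP->]; [rewrite Hs | ]; apply: Hpi.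
have FG : subrel (tree_rel r pi) G by move=> x y /FH/HG.
have exF : excess k (tree_rel r pi) <= excess k H.
  apply: leq_sum => x _; rewrite leq_sub2r //; apply/subset_leq_card/subsetP => y.
  by rewrite !inE; apply: FH.
have [ex0|ex_gt0] := posnP (excess k (tree_rel r pi)).
  pose S := SGraph (tree_rel_sym r pi) (tree_rel_irr dP).
  exists S; split=> //; split.
    split; first exact/(conn_connected r)/(tree_rel_conn dP).
    by move=> p /andP[cp up]; apply: tree_rel_acyclic dP _ cp up.
  move=> x; rewrite -subn_eq0; have /eqP := ex0.
  by rewrite /excess sum_nat_eq0 => /forallP/(_ x).
have [K [Ks KG cK exK]] := reduce_excess k2 dP FG few ex_gt0.
by apply: IHn cK => //; apply: leq_trans exK (leq_trans exF Hn).
Qed.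

(** * Counting edges *)

(** Let N be the vertices outside S other than the chosen component roots, so
    |N| = |V - S| - c(G - S).  An edge avoiding S either lies in N or joins a
    vertex of N to the root of its own component; there are at most
    C(|N|, 2) + |N| = C(|N| + 1, 2) of these.  The other edges meet S. *)
Lemma card_edges_le (G : sgraph T) S :
  #|edges G| + 'C(#|~: S|, 2) <=
  'C(#|T|, 2) + 'C((#|~: S| - num_comp G (~: S)).+1, 2).
Proof.
pose e := off S G.
have se : connect_sym e by apply/sym_connect_sym/off_sym/adj_sym.
pose rt := fingraph.root e.
pose N := ~: S :\: [set x in fingraph.roots e].
have cardN : #|N| = #|~: S| - num_comp G (~: S).
  rewrite -(cardsID [set x in fingraph.roots e] (~: S)) -/N setIC.
  rewrite (_ : num_comp G (~: S) = #|[set x in fingraph.roots e] :&: ~: S|) ?addKn //.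
  by apply: eq_card => x; rewrite !inE.
pose A1 : {set {set T}} := [set B : {set T} | #|B| == 2] :\: [set B : {set T} | B \subset ~: S].
pose A2 : {set {set T}} := [set B : {set T} | (B \subset N) & (#|B| == 2)].
pose A3 : {set {set T}} := [set [set y; rt y] | y in N].
have edge x y : x \notin S -> y \notin S -> G x y -> x \in fingraph.roots e ->
    [set x; y] \in A3.
  move=> xS yS Gxy; rewrite unfold_in => /eqP rx.
  have rxy : rt x = rt y.
    by apply/eqP; rewrite /rt fingraph.root_connect // connect1 // /e offE xS yS.
  apply/imsetP; exists y; last by rewrite -rxy /rt rx setUC.
  rewrite !inE yS andbT; apply: contraTN Gxy => /eqP ry.
  by rewrite (etrans (esym rx) (etrans rxy ry)) adj_irr.
have cover : edges G \subset A1 :|: (A2 :|: A3).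
  apply/subsetP => B /imsetP[[x y]] /=; rewrite inE /= => Gxy -> {B}.
  have xy : x != y by apply: contraTneq Gxy => ->; rewrite adj_irr.
  have c2 : #|[set x; y]| = 2 by rewrite cards2 xy.
  rewrite !in_setU in_setD !in_set c2 eqxx !subUset !sub1set !in_setD !in_setC !in_set andbT.
  have [xS|xS] //= := boolP (x \in S); have [yS|yS] //= := boolP (y \in S).
  rewrite !andbT.
  have [xr|xr] := boolP (x \in fingraph.roots e); first by rewrite edge // orbT.
  have [yr|//] := boolP (y \in fingraph.roots e).
  by rewrite setUC edge ?orbT // adj_sym.
have card1 : #|A1| + 'C(#|~: S|, 2) = 'C(#|T|, 2).
  rewrite -(card_draws T 2) -(cards_draws (~: S) 2) addnC.
  rewrite -[RHS](cardsID [set B : {set T} | B \subset ~: S]); congr (_ + _).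
  by apply: eq_card => B; rewrite !inE andbC.
have card3 : #|A3| <= #|N| by apply: leq_imset_card.
have := subset_leq_card cover; have := (leq_card_setU A1 (A2 :|: A3)).1.
have := (leq_card_setU A2 A3).1.
have card2 : #|A2| = 'C(#|N|, 2) by apply: cards_draws.
rewrite -cardN -card1 binS bin1 -card2; lia.
Qed.

End Relations.

Lemma double_bin2 x : 2 * 'C(x.+1, 2) = x * x.+1.
Proof. by rewrite -mul_bin_diag bin1 mulnC. Qed.

(** With n = s + (as + 3) + d and s = s0 + j, twice the difference of the two
    sides is at least j times (2an - (a^2 + 2a)(s + s0) - 5a - 4).  The last
    factor is nonnegative by the lower bound on n and a s + s + 3 <= n. *)
Lemma edge_bound_mono a s s0 n c :
    a * s + 3 <= c -> s + c <= n -> s0 <= s ->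
    s0 * (a * (a + 1) * (a + 2)) + 2 * a ^ 2 + 3 * a + 4 <= n * a ^ 2 ->
  'C(n, 2) + 'C((n - s - c).+1, 2) <=
  'C(n - s0 * a - 2, 2) + s0 * (s0 * a + 2) + 'C(n - s, 2).
Proof.
move=> cP nP sP bound.
have /subnKC nE : s + (a * s + 3) <= n by lia.
move: (n - _) nE => d nE.
apply: (@leq_trans ('C(n, 2) + 'C(d.+1, 2))).
  by rewrite leq_add2l leq_bin2l // ltnS; lia.
move: (subnKC sP); move: (s - s0) => j sE.
have -> : n - s0 * a - 2 = (s + a * j + d).+1 by nia.
have -> : n - s = (a * s + 2 + d).+1 by lia.
have -> : n = (s + (a * s + 2) + d).+1 by lia.
have gain : (a ^ 2 + 2 * a) * (s + s0) + 5 * a + 4 <= 2 * a * n.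
  (* The factor a + 1 makes (a + 1) s <= n - 3 applicable without division. *)
  by rewrite -(@leq_pmul2l a.+1) //; nia.
have jgain := leq_mul (leqnn j) gain.
move: (double_bin2 (s + (a * s + 2) + d)) (double_bin2 d).
move: (double_bin2 (s + a * j + d)) (double_bin2 (a * s + 2 + d)).
move: 'C(_, 2) 'C(_, 2) 'C(_, 2) 'C(_, 2) => b1 b2 b3 b4.
clear -jgain nE sE; subst s n; rewrite -?mulnn in jgain *; lia.
Qed.

Theorem theorem1p5 (R : archiRealFieldType) (T : finType) (G : sgraph T)
    (k t n s0 : nat)
    (hk : 3 <= k) (ht : 1 <= t)
    (hs0 : s0%:Z%R = Num.ceil (3 * t%:R / (t%:R + 1) : R)%R)
    (hn : #|T| = n)
    (hconn : connected G)
    (htough : tough (t%:R / (t%:R * (k%:R - 1) + 1) : R)%R G)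
    (hbound : ((s0%:R * k%:R ^+ 3 - (3 * s0%:R - 2) * k%:R ^+ 2
                + (2 * s0%:R - 5) * k%:R + 6) / (k%:R - 2) ^+ 2
               <= n%:R :> R)%R)
    (hedges : 'C(n - s0 * (k - 2) - 2, 2) + s0 * (s0 * (k - 2) + 2)
              < #|edges G|) :
  has_spanning_ktree k G.
Proof.
apply: win_theorem hconn _ => [|S _]; first exact: ltnW.
rewrite leqNgt; apply/negP => many.
have [a kE] : exists a, k = a.+3 by exists (k - 3); lia.
have a2 : k - 2 = a.+1 by lia.
have kR : (k%:R = a.+1%:R + 2 :> R)%R by rewrite kE -natrD addn2.
have order_bound : s0 <= #|S|.
  have c2 : 2 <= num_comp G (~: S).
    by apply: leq_trans (ltnW many); rewrite leq_addl.
  have := htough S c2.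
  have -> : (t%:R * (k%:R - 1) + 1 = (t * a.+2 + 1)%:R :> R)%R.
    by rewrite natrD natrM kR -[in RHS]addn1 natrD; ring.
  rewrite mulrAC ler_pdivrMr ?ltr0n ?addn1 // -!natrM ler_nat => tS.
  rewrite -lez_nat hs0 Num.Theory.ceil_le_int.
  rewrite ler_pdivrMr; last by rewrite natr1 ltr0n.
  rewrite natr1 -natrM -[(_%:~R)%R]/(#|S|%:R)%R -natrM ler_nat.
  by rewrite a2 in many; nia.
have size_bound :
    s0 * (a.+1 * (a.+1 + 1) * (a.+1 + 2)) + 2 * a.+1 ^ 2 + 3 * a.+1 + 4
    <= n * a.+1 ^ 2.
  move: hbound; rewrite kR addrK ler_pdivrMr; last by rewrite exprn_gt0 // ltr0n.
  set lhs := (X in (X <= _)%R) => bound; rewrite -(ler_nat R).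
  rewrite (_ : _%:R%R = lhs); last by rewrite /lhs !(natrD, natrM, natrX); ring.
  by rewrite natrM natrX.
have parts : #|S| + #|~: S| = n by rewrite cardsC.
have comps : num_comp G (~: S) <= #|~: S|.
  by apply/subset_leq_card/subsetP => x; rewrite !inE => /andP[].
have := card_edges_le G S.
have -> : #|~: S| = n - #|S| by lia.
have := @edge_bound_mono a.+1 #|S| s0 n (num_comp G (~: S)).
move: hedges; rewrite hn a2 in many *.
move=> hE /(_ _ _ order_bound size_bound) hm hc.
have : 'C(n - s0 * a.+1 - 2, 2) + s0 * (s0 * a.+1 + 2) >= #|edges G|.
  by rewrite -(leq_add2r 'C(n - #|S|, 2)) (leq_trans hc) // hm //; lia.
by rewrite leqNgt hE.
Qed.
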